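(* Let $a>0$ be any real number. Then there is no rotationally symmetric harmonic diffeomorphism from $P(a)$ onto $\mathbb{D}^*$, where $\mathbb{D}^*$ is equipped with its hyperbolic metric $\dfrac{|du|}{|u|\ln\frac{1}{|u|}}$.
   Context: Let $\mathbb{D}=\{z\in\mathbb{C}:|z|<1\}$, $\mathbb{D}^*=\mathbb{D}\setminus\{0\}$, and, for $a>0$, $P(a)=\mathbb{D}\setminus\{|z|\le e^{-a}\}=\{z\in\mathbb{C}: e^{-a}<|z|<1\}$. Harmonic map: let $M$ and $N$ be oriented surfaces with metrics $\tau^2|dz|^2$ and $\sigma^2|du|^2$ respectively, where $z$ and $u$ are local complex coordinates on $M$ and $N$. A $C^2$ map $u$ from $M$ to $N$ is harmonic if and only if $$u_{z\bar z}+\frac{2\sigma_u}{\sigma}\,u_z u_{\bar z}=0,$$ where $\sigma_u$ denotes the Wirtinger derivative $\partial\sigma/\partial u$ evaluated along the map (the condition does not depend on the choice of conformal metric $\tau^2|dz|^2$ on the domain). Here the domain $P(a)$ has its standard complex coordinate $z$, and the target is $\mathbb{D}^*$ with standard complex coordinate $u$ and $\sigma(u)=\dfrac{1}{|u|\ln\frac{1}{|u|}}>0$. Rotationally symmetric: with $(r,\theta)$ the polar coordinates on the domain ($z=re^{i\theta}$), a map is rotationally symmetric if it has the form $z=re^{i\theta}\mapsto g(r)e^{i\theta}$ for some positive real-valued function $g$ of $r$. *)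

(* Defs.v *)
From Stdlib Require Import Reals.
From Coquelicot Require Import Coquelicot.
Open Scope R_scope.

(** With Coquelicot's complex numbers [C = R * R], a map between plane
    domains is a total function [C -> C] together with the open sets
    [U, V : C -> Prop]; its values outside [U] play no role, since every
    notion below only depends on the map near points of [U]. *)

Definition punctured_disc (z : C) : Prop := 0 < Cmod z < 1.

Definition annulus (a : R) (z : C) : Prop := exp (- a) < Cmod z < 1.

Definition polar (r theta : R) : C := (r * cos theta, r * sin theta).

Definition Dx (f : C -> C) (z : C) : C :=
  (Derive (fun t => Re (f (t, Im z))) (Re z),
   Derive (fun t => Im (f (t, Im z))) (Re z)).

Definition Dy (f : C -> C) (z : C) : C :=
  (Derive (fun t => Re (f (Re z, t))) (Im z),
   Derive (fun t => Im (f (Re z, t))) (Im z)).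

Definition d_z (f : C -> C) (z : C) : C := (/ 2 * (Dx f z - Ci * Dy f z))%C.

Definition d_zbar (f : C -> C) (z : C) : C := (/ 2 * (Dx f z + Ci * Dy f z))%C.

(** [ex_diff_n h n x y] is existence and continuity at [(x, y)] of all
    iterated partial derivatives of [h] up to order [n]; required at every
    point of an open set [U], it says that [h] is of class C^n on [U]. *)
Definition class_C (n : nat) (U : C -> Prop) (f : C -> C) : Prop :=
  forall z : C, U z ->
    ex_diff_n (fun x y => Re (f (x, y))) n (Re z) (Im z) /\
    ex_diff_n (fun x y => Im (f (x, y))) n (Re z) (Im z).

(** The target [V] carries the metric sigma^2 |du|^2; no metric on [U] is needed
    because the equation is invariant under conformal change of the domain metric. *)
Definition harmonic_map (U V : C -> Prop) (sigma : C -> R) (u : C -> C) : Prop :=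
  class_C 2 U u /\
  (forall z : C, U z -> V (u z)) /\
  forall z : C, U z ->
    (d_zbar (d_z u) z
     + 2 * d_z (fun w => RtoC (sigma w)) (u z) / sigma (u z)
       * d_z u z * d_zbar u z = 0)%C.

(** Harmonic maps are a priori only of class C^2, so diffeomorphisms are taken
    in that class; C^infinity diffeomorphisms are particular cases. *)
Definition diffeomorphism (U V : C -> Prop) (f : C -> C) : Prop :=
  class_C 2 U f /\
  exists g : C -> C,
    class_C 2 V g /\
    (forall z : C, U z -> V (f z) /\ g (f z) = z) /\
    (forall w : C, V w -> U (g w) /\ f (g w) = w).

Definition rotationally_symmetric (U : C -> Prop) (f : C -> C) : Prop :=
  exists g : R -> R,
    forall r theta : R, 0 < r -> U (polar r theta) ->
      0 < g r /\ f (polar r theta) = polar (g r) theta.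

Definition hyperbolic_density (u : C) : R := / (Cmod u * ln (/ Cmod u)).

(* Main.v *)
Require Import Defs.
From Stdlib Require Import Reals Lra.
From Coquelicot Require Import Coquelicot.
Open Scope R_scope.

(** Write the map as [r e^(i theta) |-> g r e^(i theta)].  In the logarithmic
    coordinates [s = ln r] and [L = - ln g > 0] the punctured disc becomes
    the half-plane metric [|dw| / L], divided by a translation, and harmonicity is
    the ordinary differential equation [L L'' = L'^2 - 1], where the primes are
    derivatives in [s].  This equation has the first integral [(L'^2 - 1) / L^2];
    hence [|L'| <= K (1 + L)], and [ln (1 + L)] is Lipschitz in [s].  The
    interval [-a < s < 0] has finite length, so [L] is bounded on it and [g]
    stays away from 0: the image misses a neighbourhood of the puncture, against
    surjectivity.  The mechanism is that an annulus of finite modulus cannot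
    be stretched, rotationally and harmonically, over the infinitely long cusp.

    The proof keeps the variable [r]: the derivative of [L] in [s] is [- q] with
    [q = r g' / g] and [g'] the derivative in [r].  The equation for [g] is [radial_tension g r = 0]; it is
    obtained in [radial_harmonic_ode] by evaluating the complex equation on the
    positive real axis only.  The first integral is
    [hyperbolic_radial_first_integral], and [hyperbolic_radial_bounded_below] turns
    it into a positive lower bound for [g]. *)

(** * Polar coordinates and the modulus *)

Lemma Cmod_sqr_coord (x y : R) : Cmod (x, y) ^ 2 = x ^ 2 + y ^ 2.
Proof. unfold Cmod; cbn [fst snd]; apply pow2_sqrt; nra. Qed.

Lemma is_derive_Cmod_x (x y : R) :
  0 < Cmod (x, y) -> is_derive (fun t => Cmod (t, y)) x (x / Cmod (x, y)).
Proof.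
  intros H.
  assert (E := Cmod_sqr_coord x y).
  unfold Cmod in *; cbn [fst snd] in *.
  auto_derive.
  - nra.
  - replace (x * (x * 1) + y * (y * 1)) with (x ^ 2 + y ^ 2) by ring.
    field; lra.
Qed.

Lemma Cmod_swap (x y : R) : Cmod (x, y) = Cmod (y, x).
Proof. unfold Cmod; cbn [fst snd]; f_equal; ring. Qed.

Lemma is_derive_Cmod_y (x y : R) :
  0 < Cmod (x, y) -> is_derive (fun t => Cmod (x, t)) y (y / Cmod (x, y)).
Proof.
  intros H; rewrite Cmod_swap in *.
  apply is_derive_ext with (fun t => Cmod (t, x)).
  - intros t; apply Cmod_swap.
  - now apply is_derive_Cmod_x.
Qed.

Lemma Cmod_real_pos (r : R) : 0 < r -> Cmod (r, 0) = r.
Proof.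
  intros H; change (Cmod (RtoC r) = r); rewrite Cmod_R; apply Rabs_pos_eq; lra.
Qed.

Lemma polar_Cmod (r theta : R) : 0 <= r -> Cmod (polar r theta) = r.
Proof.
  intros H; unfold polar, Cmod; cbn [fst snd].
  replace ((r * cos theta) ^ 2 + (r * sin theta) ^ 2) with (r ^ 2).
  - now apply sqrt_pow2.
  - assert (E := sin2_cos2 theta); unfold Rsqr in E; nra.
Qed.

(** The arc cosine of [x / |z|] has the right cosine; its sine is
    [|y| / |z|], so the sign of [y] decides between it and its opposite. *)
Lemma polar_exists (z : C) : 0 < Cmod z -> exists theta, z = polar (Cmod z) theta.
Proof.
  destruct z as [x y]; intros H.
  assert (E := Cmod_sqr_coord x y).
  set (r := Cmod (x, y)) in *.
  assert (Hx : -1 <= x / r <= 1).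
  { split; [apply Rle_div_r | apply Rle_div_l]; nra. }
  assert (Hs : sqrt (1 - (x / r)²) = Rabs y / r).
  { rewrite <- (Rabs_pos_eq r) at 2 by lra.
    rewrite <- Rabs_div by lra.
    rewrite <- sqrt_Rsqr_abs; f_equal; unfold Rsqr.
    field_simplify_eq; nra. }
  unfold polar.
  destruct (Rle_dec 0 y) as [Hy | Hy].
  - exists (acos (x / r)).
    rewrite cos_acos, sin_acos, Hs, Rabs_pos_eq by lra.
    f_equal; field; lra.
  - exists (- acos (x / r)).
    rewrite cos_neg, sin_neg, cos_acos, sin_acos, Hs, Rabs_left by lra.
    f_equal; field; lra.
Qed.

(** * Wirtinger derivatives of radial expressions *)

(** Slices of the annulus are open, which is all the openness that partial
    derivatives along the axes see. *)
Lemma annulus_locally_x (a x y : R) :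
  annulus a (x, y) -> locally x (fun t => annulus a (t, y)).
Proof.
  intros H.
  assert (Hp : 0 < Cmod (x, y)) by (assert (P := exp_pos (- a)); destruct H; lra).
  assert (Hc : continuous (fun t => Cmod (t, y)) x).
  { apply @ex_derive_continuous; eexists; now apply is_derive_Cmod_x. }
  apply (Hc (fun r => exp (- a) < r < 1)).
  apply (open_and (fun r => exp (- a) < r) (fun r => r < 1) (open_gt _) (open_lt _)).
  exact H.
Qed.

Lemma annulus_locally_y (a x y : R) :
  annulus a (x, y) -> locally y (fun t => annulus a (x, t)).
Proof.
  unfold annulus; intros H; rewrite Cmod_swap in H.
  generalize (annulus_locally_x a y x H); apply filter_imp.
  unfold annulus; intros t; now rewrite Cmod_swap.
Qed.

(** Derivatives of a map known only on the annulus, here [u] and then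
    [d_z u], may be computed on an explicit formula that is valid there. *)
Lemma wirtinger_ext (a : R) (f1 f2 : C -> C) (z : C) :
  (forall w, annulus a w -> f1 w = f2 w) -> annulus a z ->
  d_z f1 z = d_z f2 z /\ d_zbar f1 z = d_zbar f2 z.
Proof.
  destruct z as [x y]; intros E H.
  assert (Hx : Defs.Dx f1 (x, y) = Defs.Dx f2 (x, y)).
  { unfold Defs.Dx; cbn [Re Im fst snd]; f_equal; apply Derive_ext_loc;
      generalize (annulus_locally_x a x y H); apply filter_imp;
      intros t Ht; now rewrite E. }
  assert (Hy : Dy f1 (x, y) = Dy f2 (x, y)).
  { unfold Dy; cbn [Re Im fst snd]; f_equal; apply Derive_ext_loc;
      generalize (annulus_locally_y a x y H); apply filter_imp;
      intros t Ht; now rewrite E. }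
  unfold d_z, d_zbar; now rewrite Hx, Hy.
Qed.

(** Chain rule with [d_z |z| = Cconj z / (2 |z|)] and
    [d_zbar |z| = z / (2 |z|)]. *)
Lemma wirtinger_radial (phi : R -> R) (z : C) (l : R) :
  0 < Cmod z -> is_derive phi (Cmod z) l ->
  d_z (fun w => RtoC (phi (Cmod w))) z = (RtoC (l / (2 * Cmod z)) * Cconj z)%C /\
  d_zbar (fun w => RtoC (phi (Cmod w))) z = (RtoC (l / (2 * Cmod z)) * z)%C.
Proof.
  destruct z as [x y]; intros H Hl.
  assert (Hx : Derive (fun t => phi (Cmod (t, y))) x = x / Cmod (x, y) * l).
  { apply is_derive_unique.
    apply (is_derive_comp phi (fun t => Cmod (t, y)) x _ _ Hl).
    now apply is_derive_Cmod_x. }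
  assert (Hy : Derive (fun t => phi (Cmod (x, t))) y = y / Cmod (x, y) * l).
  { apply is_derive_unique.
    apply (is_derive_comp phi (fun t => Cmod (x, t)) y _ _ Hl).
    now apply is_derive_Cmod_y. }
  unfold d_z, d_zbar, Defs.Dx, Dy, RtoC; cbn [Re Im fst snd].
  rewrite Hx, Hy, !Derive_const.
  split; apply injective_projections;
    unfold Cminus, Cmult, Cplus, Copp, Cinv, Ci, Cconj; cbn [fst snd]; field; lra.
Qed.

(** The null terms in this lemma and the next are those that arise from the
    imaginary part of a real factor in a complex product. *)
Lemma Derive_mult_id (H : R -> R) (x d : R) :
  is_derive H x d -> forall c,
  Derive (fun t => H t * t - 0 * c) x = d * x + H x /\
  Derive (fun t => H t * t + 0 * c) x = d * x + H x.
Proof.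
  intros Hd c; split; apply is_derive_unique; auto_derive;
    try (repeat split; now exists d);
    change (fun x : R => H x) with H; rewrite (is_derive_unique _ _ _ Hd); ring.
Qed.

Lemma Derive_mult_const (H : R -> R) (x d : R) :
  is_derive H x d -> forall c,
  Derive (fun t => H t * c - 0 * t) x = d * c /\
  Derive (fun t => H t * c + 0 * t) x = d * c.
Proof.
  intros Hd c; split; apply is_derive_unique; auto_derive;
    try (repeat split; now exists d);
    change (fun x : R => H x) with H; rewrite (is_derive_unique _ _ _ Hd); ring.
Qed.

(** Leibniz rule for the product of a radial factor and [z].  Since
    [Cconj z * z = |z|^2], the derivative [d_z] is again radial: this is what makes a
    second application of [wirtinger_radial] give the Laplacian. *)
Lemma wirtinger_radial_mult (h : R -> R) (z : C) (l : R) :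
  0 < Cmod z -> is_derive h (Cmod z) l ->
  d_z (fun w => RtoC (h (Cmod w)) * w)%C z = RtoC (h (Cmod z) + Cmod z * l / 2) /\
  d_zbar (fun w => RtoC (h (Cmod w)) * w)%C z
    = (RtoC (l / (2 * Cmod z)) * (z * z))%C.
Proof.
  destruct z as [x y]; intros H Hl.
  assert (Hx : is_derive (fun t => h (Cmod (t, y))) x (x / Cmod (x, y) * l)).
  { apply (is_derive_comp h (fun t => Cmod (t, y)) x _ _ Hl).
    now apply is_derive_Cmod_x. }
  assert (Hy : is_derive (fun t => h (Cmod (x, t))) y (y / Cmod (x, y) * l)).
  { apply (is_derive_comp h (fun t => Cmod (x, t)) y _ _ Hl).
    now apply is_derive_Cmod_y. }
  assert (E := Cmod_sqr_coord x y).
  unfold d_z, d_zbar, Defs.Dx, Dy, RtoC, Cmult; cbn [Re Im fst snd].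
  set (m := Cmod (x, y)) in *.
  assert (Hxr : Derive (fun t => h (Cmod (t, y)) * t - 0 * y) x = x / m * l * x + h m).
  { apply (Derive_mult_id _ _ _ Hx). }
  assert (Hxi : Derive (fun t => h (Cmod (t, y)) * y + 0 * t) x = x / m * l * y).
  { apply (Derive_mult_const _ _ _ Hx). }
  assert (Hyr : Derive (fun t => h (Cmod (x, t)) * x - 0 * t) y = y / m * l * x).
  { apply (Derive_mult_const _ _ _ Hy). }
  assert (Hyi : Derive (fun t => h (Cmod (x, t)) * t + 0 * x) y = y / m * l * y + h m).
  { apply (Derive_mult_id _ _ _ Hy). }
  rewrite Hxr, Hxi, Hyr, Hyi.
  split; apply injective_projections;
    unfold Cminus, Cmult, Cplus, Copp, Cinv, Ci; cbn [fst snd];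
    field_simplify_eq; try lra.
  rewrite E; ring.
Qed.

(** * The equation of the profile *)

(** Four times the left-hand side of the harmonic map equation of
    [r e^(i theta) |-> g r e^(i theta)], at a positive real point [r]: the
    polar form of the Laplacian, then [2 sigma_u / sigma = (1 / u) (1 / ln (1 / u) - 1)]
    at [u = g r], times [4 u_z u_zbar = g'^2 - (g / r)^2]. *)
Definition radial_tension (g : R -> R) (r : R) : R :=
  Derive (Derive g) r + Derive g r / r - g r / r ^ 2
  + / g r * (- / ln (g r) - 1) * (Derive g r ^ 2 - (g r / r) ^ 2).

(** By rotational symmetry the positive real axis carries all the information;
    there every factor of the complex equation is real.  The one second-order
    term is a derivative of [d_z u = (g' + g / r) / 2], which is known near
    the axis and not only on it. *)
Lemma radial_harmonic_ode (a : R) (u : C -> C) (g : R -> R) :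
  (forall r, exp (- a) < r < 1 ->
     0 < g r < 1 /\ ex_derive g r /\ ex_derive (Derive g) r) ->
  (forall z, annulus a z -> u z = (RtoC (g (Cmod z) / Cmod z) * z)%C) ->
  forall r, exp (- a) < r < 1 ->
  (d_zbar (d_z u) r
   + 2 * d_z (fun w => RtoC (hyperbolic_density w)) (u r) / hyperbolic_density (u r)
     * d_z u r * d_zbar u r = 0)%C ->
  radial_tension g r = 0.
Proof.
  intros Hg Hu r Hr Eq.
  assert (Hpos : forall z, annulus a z -> 0 < Cmod z).
  { intros z [H _]; assert (P := exp_pos (- a)); lra. }
  assert (Hl : forall z, annulus a z ->
    is_derive (fun s => g s / s) (Cmod z)
      (Derive g (Cmod z) / Cmod z - g (Cmod z) / Cmod z ^ 2)).
  { intros z Hz; specialize (Hpos z Hz); destruct (Hg _ Hz) as (_ & Hd & _).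
    auto_derive; [repeat split; auto; lra |].
    change (fun x : R => g x) with g; field; lra. }
  assert (Hdz : forall z, annulus a z ->
    d_z u z = RtoC ((Derive g (Cmod z) + g (Cmod z) / Cmod z) / 2)).
  { intros z Hz; specialize (Hpos z Hz).
    rewrite (proj1 (wirtinger_ext a u _ z Hu Hz)).
    rewrite (proj1 (wirtinger_radial_mult (fun s => g s / s) z _ Hpos (Hl z Hz))).
    f_equal; field; lra. }
  assert (Hr0 : 0 < r) by (assert (P := exp_pos (- a)); lra).
  assert (Hm : Cmod (RtoC r) = r) by now apply Cmod_real_pos.
  assert (Hz : annulus a (RtoC r)) by (unfold annulus; now rewrite Hm).
  destruct (Hg r Hr) as (Hgr & Hd1 & Hd2).
  assert (Hlap : d_zbar (d_z u) r
    = RtoC ((Derive (Derive g) r + Derive g r / r - g r / r ^ 2) / 4)).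
  { rewrite (proj2 (wirtinger_ext a _ _ (RtoC r) Hdz Hz)).
    assert (Hk : is_derive (fun s => (Derive g s + g s / s) / 2) (Cmod (RtoC r))
      ((Derive (Derive g) r + Derive g r / r - g r / r ^ 2) / 2)).
    { rewrite Hm; auto_derive; [repeat split; auto; lra |].
      change (fun x : R => g x) with g.
      change (fun x : R => Derive g x) with (Derive g).
      field; lra. }
    rewrite (proj2 (wirtinger_radial _ _ _ (Hpos _ Hz) Hk)).
    rewrite Hm, <- RtoC_mult; f_equal; field; lra. }
  assert (Hdb : d_zbar u r = RtoC ((Derive g r - g r / r) / 2)).
  { rewrite (proj2 (wirtinger_ext a u _ (RtoC r) Hu Hz)).
    rewrite (proj2 (wirtinger_radial_mult (fun s => g s / s) _ _ (Hpos _ Hz) (Hl _ Hz))).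
    rewrite Hm, <- !RtoC_mult; f_equal; field; lra. }
  assert (Hur : u r = RtoC (g r)).
  { rewrite (Hu _ Hz), Hm, <- RtoC_mult; f_equal; field; lra. }
  assert (Hgm : Cmod (RtoC (g r)) = g r) by (apply Cmod_real_pos; lra).
  assert (Hln : ln (g r) < 0) by (rewrite <- ln_1; apply ln_increasing; lra).
  assert (Hsig : d_z (fun w => RtoC (hyperbolic_density w)) (u r)
    = RtoC ((ln (g r) + 1) / (2 * (g r * ln (g r)) ^ 2))).
  { rewrite Hur.
    assert (Hd : is_derive (fun s => / (s * ln (/ s))) (Cmod (RtoC (g r)))
      ((ln (g r) + 1) / (g r * ln (g r)) ^ 2)).
    { rewrite Hgm.
      auto_derive; rewrite ?ln_Rinv by lra.
      - repeat split; try lra; [apply Rinv_0_lt_compat; lra | nra].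
      - field; lra. }
    unfold hyperbolic_density.
    rewrite (proj1 (wirtinger_radial _ _ _ ltac:(rewrite Hgm; lra) Hd)).
    replace (Cconj (RtoC (g r))) with (RtoC (g r))
      by (unfold Cconj, RtoC; cbn [fst snd]; now rewrite Ropp_0).
    rewrite Hgm, <- RtoC_mult; f_equal; field; lra. }
  assert (Hs : hyperbolic_density (u r) = - / (g r * ln (g r))).
  { unfold hyperbolic_density; rewrite Hur, Hgm, ln_Rinv by lra; field; lra. }
  rewrite Hlap, Hsig, Hs, (Hdz _ Hz), Hdb, Hm in Eq.
  unfold Cdiv in Eq.
  rewrite <- RtoC_inv in Eq
    by (apply Ropp_neq_0_compat, Rinv_neq_0_compat; nra).
  rewrite <- !RtoC_mult, <- RtoC_plus in Eq.
  apply RtoC_inj in Eq; unfold radial_tension.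
  apply (Rmult_eq_reg_l (/ 4)); [rewrite Rmult_0_r, <- Eq; field; lra | lra].
Qed.

(** With [q = r g' / g] and [L = - ln g], the equation reads
    [r q' = - (q^2 - 1) / L], while [r L' = - q]; so both terms of the derivative
    of [(q^2 - 1) / L^2] cancel. *)
Lemma hyperbolic_radial_first_integral (g : R -> R) (r : R) :
  0 < r -> 0 < g r < 1 -> ex_derive g r -> ex_derive (Derive g) r ->
  radial_tension g r = 0 ->
  is_derive (fun s => ((s * Derive g s / g s) ^ 2 - 1) / ln (g s) ^ 2) r 0.
Proof.
  unfold radial_tension; intros Hr Hg Hd1 Hd2 Eq.
  assert (Hln : ln (g r) < 0) by (rewrite <- ln_1; apply ln_increasing; lra).
  auto_derive.
  - repeat split; auto; nra.
  - change (fun x : R => g x) with g; change (fun x : R => Derive g x) with (Derive g).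
    replace (Derive (Derive g) r) with
      (- (Derive g r / r - g r / r ^ 2
        + / g r * (- / ln (g r) - 1) * (Derive g r ^ 2 - (g r / r) ^ 2))) by lra.
    field; lra.
Qed.

(** * Solutions do not reach the puncture *)

(** A form of the Gronwall inequality: [ln (1 + f)] has a derivative bounded by
    [K], so by the mean value theorem it varies by at most [K (c - b)]. *)
Lemma bounded_of_log_derivative_bound (f df : R -> R) (K b c : R) :
  0 <= K ->
  (forall x, b < x < c -> 0 <= f x /\ is_derive f x (df x)
                          /\ Rabs (df x) <= K * (1 + f x)) ->
  exists M, forall x, b < x < c -> f x <= M.
Proof.
  intros HK H.
  destruct (Rlt_dec b c) as [Hbc | Hbc]; [| exists 0; intros; lra].
  set (m := (b + c) / 2).
  assert (Hm : b < m < c) by (unfold m; lra).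
  assert (HD : forall x, b < x < c ->
    is_derive (fun t => ln (1 + f t)) x (df x / (1 + f x))).
  { intros x Hx; destruct (H x Hx) as (H0 & H1 & _).
    auto_derive; [split; [now exists (df x) | split; [lra | easy]] |].
    change (fun x : R => f x) with f; rewrite (is_derive_unique _ _ _ H1).
    field; lra. }
  exists (exp (ln (1 + f m) + K * (c - b))); intros x Hx.
  assert (Hin : forall t, Rmin m x <= t <= Rmax m x -> b < t < c).
  { intros t; destruct (Rle_dec m x) as [L | L];
      [rewrite Rmin_left, Rmax_right | rewrite Rmin_right, Rmax_left]; lra. }
  destruct (MVT_gen (fun t => ln (1 + f t)) m x (fun t => df t / (1 + f t)))
    as (t & Ht & E).
  - intros t Ht; apply HD, Hin; lra.
  - intros t Ht; apply continuity_pt_filterlim.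
    apply (@ex_derive_continuous R_AbsRing R_NormedModule (fun t => ln (1 + f t))).
    eexists; apply HD, Hin; lra.
  - destruct (H x Hx) as (Hfx & _ & _).
    destruct (H t (Hin t Ht)) as (Hft & _ & Hb).
    assert (Hq : Rabs (df t / (1 + f t)) <= K).
    { rewrite Rabs_div, (Rabs_pos_eq (1 + f t)) by lra.
      apply Rle_div_l; lra. }
    assert (Hxm : Rabs (x - m) <= c - b) by (apply Rabs_le; lra).
    assert (P := Rle_abs (df t / (1 + f t) * (x - m))).
    rewrite Rabs_mult in P.
    assert (Q := Rmult_le_compat _ _ _ _ (Rabs_pos _) (Rabs_pos _) Hq Hxm).
    apply Rle_trans with (exp (ln (1 + f x))); [rewrite exp_ln; lra |].
    destruct (Req_dec (ln (1 + f x)) (ln (1 + f m) + K * (c - b))) as [Eq | Ne];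
      [rewrite Eq; lra | left; apply exp_increasing; lra].
Qed.

(** Let [L = - ln g], [q = r g' / g] and [k] the constant value of the first integral.  Then
    [q^2 = 1 + k L^2 <= ((1 + |k|) (1 + L))^2], and [L' = - q / r] with [r]
    bounded below by the inner radius [exp (- a)]; this feeds the previous
    lemma, and a bound [L <= M] means [g >= exp (- M)]. *)
Lemma hyperbolic_radial_bounded_below (a : R) (g : R -> R) :
  (forall r, exp (- a) < r < 1 ->
     0 < g r < 1 /\ ex_derive g r /\ ex_derive (Derive g) r /\
     radial_tension g r = 0) ->
  exists d, 0 < d < 1 /\ forall r, exp (- a) < r < 1 -> d < g r.
Proof.
  intros H.
  assert (P := exp_pos (- a)).
  set (E := fun s => ((s * Derive g s / g s) ^ 2 - 1) / ln (g s) ^ 2).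
  assert (HE : exists k, forall r, exp (- a) < r < 1 -> E r = k).
  { exists (E ((exp (- a) + 1) / 2)); intros r Hr.
    assert (HE0 : forall r, exp (- a) < r < 1 -> is_derive E r zero).
    { intros t Ht; destruct (H t Ht) as (H0 & H1 & H2 & H3).
      apply hyperbolic_radial_first_integral; auto; lra. }
    destruct (Rtotal_order r ((exp (- a) + 1) / 2)) as [L | [L | L]].
    - apply (eq_is_derive E); auto; intros t Ht; apply HE0; lra.
    - now rewrite L.
    - symmetry; apply (eq_is_derive E); auto; intros t Ht; apply HE0; lra. }
  destruct HE as [k Hk].
  destruct (bounded_of_log_derivative_bound (fun r => - ln (g r))
    (fun r => - Derive g r / g r) ((1 + Rabs k) / exp (- a)) (exp (- a)) 1)
    as [M HM].
  - apply Rle_mult_inv_pos; [assert (Q := Rabs_pos k); lra | easy].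
  - intros r Hr; destruct (H r Hr) as (H0 & H1 & _).
    assert (Hln : ln (g r) < 0) by (rewrite <- ln_1; apply ln_increasing; lra).
    split; [lra | split].
    + auto_derive; [repeat split; auto; lra |].
      change (fun x : R => g x) with g; field; lra.
    + specialize (Hk r Hr); unfold E in Hk.
      set (q := r * Derive g r / g r) in *.
      set (L := - ln (g r)).
      assert (HL : 0 < L) by (unfold L; lra).
      assert (Hq : q ^ 2 = 1 + k * L ^ 2).
      { rewrite <- Hk; unfold L; field; lra. }
      assert (Habs : Rabs q <= (1 + Rabs k) * (1 + L)).
      { (* After expansion, the right side exceeds the left by nonnegative monomials. *)
        assert (Hk0 := Rabs_pos k); assert (Hk1 := Rle_abs k).
        rewrite <- (Rabs_pos_eq ((1 + Rabs k) * (1 + L))) by nra.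
        apply Rsqr_le_abs_0; unfold Rsqr.
        replace (q * q) with (1 + k * L ^ 2) by (rewrite <- Hq; ring).
        assert (k * L ^ 2 <= Rabs k * L ^ 2) by nra.
        assert (0 <= Rabs k * L) by nra.
        assert (0 <= Rabs k * L * L) by nra.
        assert (0 <= Rabs k * Rabs k) by nra.
        assert (0 <= (Rabs k * Rabs k) * (1 + L) ^ 2) by (apply Rmult_le_pos; nra).
        nra. }
      replace (- Derive g r / g r) with (- q / r) by (unfold q; field; lra).
      rewrite Rabs_div, Rabs_Ropp, (Rabs_pos_eq r) by lra.
      unfold Rdiv; rewrite (Rmult_assoc _ (/ exp (- a))), (Rmult_comm (/ exp (- a))).
      rewrite <- Rmult_assoc.
      apply Rmult_le_compat; try easy.
      * apply Rabs_pos.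
      * left; apply Rinv_0_lt_compat; lra.
      * apply Rinv_le_contravar; lra.
  - (* [Rmax M 0] makes the exponent negative; the extra 1 makes the inequality strict. *)
    exists (exp (- Rmax M 0 - 1)); split.
    + split; [apply exp_pos |].
      assert (Q := Rmax_r M 0); rewrite <- exp_0 at 2; apply exp_increasing; lra.
    + intros r Hr; destruct (H r Hr) as ((H0 & _) & _).
      specialize (HM r Hr); assert (Q := Rmax_l M 0).
      rewrite <- (exp_ln (g r)) by easy; apply exp_increasing; lra.
Qed.

(** * Rotationally symmetric maps *)

(** The symmetry hypothesis says nothing about the profile away from the radii of
    the annulus, nor about its smoothness.  The profile used here is
    [Re (u r)] on the real axis, which is a slice of the map itself, so that its
    derivatives are partial derivatives of a map of class C^2. *)
Lemma rotationally_symmetric_profile (a : R) (u : C -> C) :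
  class_C 2 (annulus a) u -> rotationally_symmetric (annulus a) u ->
  exists g : R -> R,
    (forall r, exp (- a) < r < 1 ->
       0 < g r /\ ex_derive g r /\ ex_derive (Derive g) r) /\
    forall z, annulus a z -> u z = (RtoC (g (Cmod z) / Cmod z) * z)%C.
Proof.
  intros Hc [g Hg].
  assert (P := exp_pos (- a)).
  assert (Hreal : forall r, exp (- a) < r < 1 -> annulus a (r, 0)).
  { intros r Hr; unfold annulus; now rewrite Cmod_real_pos by lra. }
  assert (Hu : forall r, exp (- a) < r < 1 -> 0 < g r /\ Re (u (r, 0)) = g r).
  { intros r Hr.
    assert (E : polar r 0 = (r, 0)) by
      (unfold polar; rewrite cos_0, sin_0; f_equal; ring).
    destruct (Hg r 0) as [H0 H1]; [lra | rewrite E; now apply Hreal |].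
    split; [easy |]; rewrite <- E, H1; unfold polar; cbn [Re fst].
    rewrite cos_0; ring. }
  exists (fun r => Re (u (r, 0))); split.
  - intros r Hr; split; [rewrite (proj2 (Hu r Hr)); apply (Hu r Hr) |].
    destruct (Hc _ (Hreal r Hr)) as [(_ & H1 & _ & (_ & H2 & _) & _) _].
    cbn [Re Im fst snd] in H1, H2; now split.
  - intros z Hz.
    assert (Hp : 0 < Cmod z) by (destruct Hz; lra).
    rewrite (proj2 (Hu _ Hz)).
    destruct (polar_exists z Hp) as [theta E].
    rewrite E in Hz; destruct (Hg _ _ Hp Hz) as [_ H].
    rewrite <- E in H; rewrite H, E at 1.
    rewrite polar_Cmod by lra.
    rewrite E at 4.
    unfold polar, RtoC, Cmult; cbn [fst snd]; f_equal; field; lra.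
Qed.

Theorem theorem1p2 (a : R) (ha : 0 < a) :
  ~ exists u : C -> C,
      harmonic_map (annulus a) punctured_disc hyperbolic_density u /\
      diffeomorphism (annulus a) punctured_disc u /\
      rotationally_symmetric (annulus a) u.
Proof.
  intros (u & (Hc & Hmap & Heq) & (_ & v & _ & _ & Honto) & Hrot).
  assert (P := exp_pos (- a)).
  destruct (rotationally_symmetric_profile a u Hc Hrot) as (g & Hg & Hu).
  assert (Hmod : forall z, annulus a z -> Cmod (u z) = g (Cmod z)).
  { intros z Hz; assert (Hp : 0 < Cmod z) by (destruct Hz; lra).
    destruct (Hg _ Hz) as [H0 _].
    rewrite (Hu z Hz), Cmod_mult, Cmod_R, Rabs_pos_eq.
    - field; lra.
    - apply Rle_mult_inv_pos; lra. }
  assert (Hreal : forall r, exp (- a) < r < 1 -> annulus a (RtoC r)).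
  { intros r Hr; unfold annulus; change (RtoC r) with (r, 0).
    now rewrite Cmod_real_pos by lra. }
  assert (Hg' : forall r, exp (- a) < r < 1 ->
    0 < g r < 1 /\ ex_derive g r /\ ex_derive (Derive g) r).
  { intros r Hr; destruct (Hg r Hr) as (H0 & H1 & H2).
    repeat split; auto.
    destruct (Hmap _ (Hreal r Hr)) as [_ H].
    rewrite Hmod in H by now apply Hreal.
    change (RtoC r) with (r, 0) in H.
    now rewrite Cmod_real_pos in H by lra. }
  destruct (hyperbolic_radial_bounded_below a g) as (d & Hd & Hlow).
  { intros r Hr; destruct (Hg' r Hr) as (H0 & H1 & H2); repeat split; auto; try easy.
    apply (radial_harmonic_ode a u g Hg' Hu r Hr), Heq, Hreal, Hr. }
  (* The preimage of the point [d] has modulus [r] with [g r = d], against [d < g r]. *)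
  destruct (Honto (RtoC d)) as [Hv Huv].
  { unfold punctured_disc; change (RtoC d) with (d, 0).
    now rewrite Cmod_real_pos by easy. }
  specialize (Hlow _ Hv).
  rewrite <- (Hmod _ Hv), Huv in Hlow.
  change (RtoC d) with (d, 0) in Hlow.
  rewrite Cmod_real_pos in Hlow by easy; lra.
Qed.
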